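(* Let $K$ be a nonarchimedean local field of characteristic zero, $E/K$ an elliptic curve with good reduction, $X=E-\{\infty\}$ given by $y^2=4x^3-60e_4x-140e_6$, $\alpha=dx/y$, $\beta=x\,dx/y$, and $b\in X(K)$. The connection $$\nabla_{KZB}=d-\omega_{KZB},\qquad \omega_{KZB}=\beta B+\alpha\exp\left(-\sum_{k=2}^\infty\frac{(-1)^kP_k\,\mathrm{ad}_B^k}{k}\right)(A)$$ on $\mathcal{O}_X\langle\langle A,B\rangle\rangle$, with the marked element $1\in\mathcal{O}_X\langle\langle A,B\rangle\rangle$ (in the fibre over $b$), represents the universal unipotent pointed connection on $X$ (based at $b$).
   Context: $K\langle\langle A,B\rangle\rangle$ is the ring of noncommutative formal power series; $\omega_{KZB}$ acts by left multiplication, and $\mathrm{ad}_B(w)=Bw-wB$. $\mathcal{O}_X\langle\langle A,B\rangle\rangle$ is regarded as the inverse limit over $n$ of its truncations by words of degree $>n$, each of which is a unipotent flat connection of finite rank. Functions $P_k$: fix an embedding $K\hookrightarrow\mathbb{C}$, let $z=\int_\infty\alpha$ be the Abel–Jacobi coordinate and $x=\wp(z)=z^{-2}+\sum_{n\ge1}(2n+1)e_{2n+2}z^{2n}$; put $e_2=0$ and $e_n=0$ for $n$ odd. For $k\ge 2$, $P_k$ is the regular algebraic function on $X$ which is the pullback of $\frac{(-1)^k}{(k-1)!}\frac{d^{k-2}\wp}{dz^{k-2}}-e_k$ under the Abel–Jacobi map; thus $P_2=x$, $P_3=-y/2$ and $P_k=z^{-k}+O(z)$ near $z=0$. A pointed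 unipotent flat connection on $X$ based at $b$ is a triple $(\mathscr{E},\nabla,v)$ with $(\mathscr{E},\nabla)$ a flat connection obtained as an iterated extension of trivial connections and $v\in\mathscr{E}_b$. The universal pointed unipotent flat connection is the (pro-)object $(\mathscr{E}_0,\nabla_0,v_0)$ such that for every pointed unipotent flat connection $(\mathscr{E},\nabla,v)$ there is a unique morphism of connections $\phi:\mathscr{E}_0\to\mathscr{E}$ with $\phi_b(v_0)=v$; it is unique up to unique isomorphism. *)

(* Defs.v *)
From HB Require Import structures.
From mathcomp Require Import all_boot all_order all_algebra complex.
From mathcomp Require Import all_classical all_reals all_analysis.
From mathcomp Require Import ring.
Set Implicit Arguments.
Unset Strict Implicit.
Unset Printing Implicit Defensive.
Import Order.TTheory GRing.Theory Num.Theory.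
Import numFieldNormedType.Exports.
Local Open Scope classical_set_scope.
Local Open Scope ring_scope.

Section LocalField.
Variables (K : fieldType) (v : K -> int).

(* [v] is meaningful on nonzero elements only; [val_ge x m] is "v x >= m" with
   the convention v 0 = +oo. *)
Definition val_ge (x : K) (m : int) : bool := (x == 0) || (m <= v x).

Record nonarch_local_field : Prop := NonarchLocalField {
  val_mul : forall x y, x != 0 -> y != 0 -> v (x * y) = v x + v y;
  val_add : forall x y m, val_ge x m -> val_ge y m -> val_ge (x + y) m;
  val_uniformizer : exists2 p, p != 0 & v p = 1;
  val_complete : forall u : nat -> K,
    (forall m : int, exists N, forall i j,
       (N <= i)%N -> (N <= j)%N -> val_ge (u i - u j) m) ->
    exists l, forall m : int, exists N, forall i,
       (N <= i)%N -> val_ge (u i - l) m;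
  val_finite_residue_field : exists s : seq K, forall x, val_ge x 0 ->
    exists2 r, r \in s & val_ge (x - r) 1
}.

(* Discriminant of y^2 + a1 x y + a3 y = x^3 + a2 x^2 + a4 x + a6. *)
Definition weierstrass_disc (a1 a2 a3 a4 a6 : K) : K :=
  let b2 := a1 ^+ 2 + 4 * a2 in
  let b4 := 2 * a4 + a1 * a3 in
  let b6 := a3 ^+ 2 + 4 * a6 in
  let b8 := a1 ^+ 2 * a6 + 4 * a2 * a6 - a1 * a3 * a4 + a2 * a3 ^+ 2
            - a4 ^+ 2 in
  - b2 ^+ 2 * b8 - 8 * b4 ^+ 3 - 27 * b6 ^+ 2 + 9 * b2 * b4 * b6.

(* The projective closure of y^2 = 4 x^3 - 60 e4 x - 140 e6 is an elliptic
   curve. *)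
Definition nonsingular (e4 e6 : K) : Prop :=
  (60 * e4) ^+ 3 - 27 * (140 * e6) ^+ 2 != 0.

(* Over K the curve is isomorphic, fixing the point at infinity, to one given
   by a Weierstrass equation with coefficients in the valuation ring and unit
   discriminant.  The factor 2 turns y^2 = 4 x^3 - ... into an equation with
   leading coefficients 1; K being infinite, the identity of functions is an
   identity of polynomials. *)
Definition good_reduction (e4 e6 : K) : Prop :=
  exists a1 a2 a3 a4 a6 u r s t : K,
  [/\ [&& val_ge a1 0, val_ge a2 0, val_ge a3 0, val_ge a4 0 & val_ge a6 0],
      weierstrass_disc a1 a2 a3 a4 a6 != 0,
      v (weierstrass_disc a1 a2 a3 a4 a6) = 0,
      u != 0
    & forall x' y' : K,
        let x := u ^+ 2 * x' + r in
        let y := 2 * (u ^+ 3 * y' + s * u ^+ 2 * x' + t) in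
        y ^+ 2 - (4 * x ^+ 3 - 60 * e4 * x - 140 * e6) =
        4 * u ^+ 6 * (y' ^+ 2 + a1 * x' * y' + a3 * y'
                      - (x' ^+ 3 + a2 * x' ^+ 2 + a4 * x' + a6))].

End LocalField.

Record derivation (O : comNzRingType) := Derivation {
  der_fun :> O -> O;
  derD : forall f g, der_fun (f + g) = der_fun f + der_fun g;
  derM : forall f g, der_fun (f * g) = der_fun f * g + f * der_fun g
}.

Section Curve.
Variables (K : fieldType) (e4 e6 : K).

Definition cubic : {poly K} := 4 *: 'X^3 - (60 * e4) *: 'X - (140 * e6)%:P.

(* An element of {poly {poly K}} is a polynomial in y over K[x]. *)
Definition eqX : {poly {poly K}} := 'X^2 - cubic%:P.

(* The ring O(X) of regular functions on X : y^2 = 4 x^3 - 60 e4 x - 140 e6. *)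
Definition OX := {poly %/ eqX}.

Definition cstX (c : K) : OX := in_qpoly eqX c%:P%:P.
Definition xX : OX := in_qpoly eqX ('X%:P).
Definition yX : OX := in_qpoly eqX 'X.

Definition half_dcubic : {poly K} := 6 *: 'X^2 - (30 * e4)%:P.

Definition derXY (p : {poly {poly K}}) : {poly {poly K}} :=
  map_poly (@deriv K) p * 'X + p^`()%R * half_dcubic%:P.

(* The derivation of O(X) dual to alpha = dx/y, i.e. df = (dX f) alpha; thus
   dX x = y and dX y = 6 x^2 - 30 e4. *)
Definition dX_fun (f : OX) : OX := in_qpoly eqX (derXY f).

Lemma size_eqX : size eqX = 3%N.
Proof.
rewrite /eqX size_polyDl ?size_polyXn // size_polyN.
by rewrite (leq_ltn_trans (size_polyC_leq1 _)).
Qed.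

Lemma eqX_monic : eqX \is monic.
Proof.
rewrite monicE lead_coefDl ?lead_coefXn //.
by rewrite size_polyXn size_polyN (leq_ltn_trans (size_polyC_leq1 _)).
Qed.

Lemma mk_monic_eqX : mk_monic eqX = eqX.
Proof. by rewrite /mk_monic size_eqX eqX_monic. Qed.

Lemma val_OXK (f : OX) : in_qpoly eqX (f : {poly {poly K}}) = f.
Proof. by apply/val_inj/in_qpoly_small/size_mk_monic. Qed.

Lemma in_qpoly_eqX : in_qpoly eqX eqX = 0.
Proof.
apply/val_inj; rewrite /= mk_monic_eqX; exact: Pdiv.RingMonic.rmodpp eqX_monic.
Qed.

Lemma dcubicE : cubic^`()%R = 2 *: half_dcubic.
Proof.
rewrite /cubic /half_dcubic !derivB !derivZ derivXn derivX derivC subr0.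
by rewrite -!mul_polyC !polyCM !polyC_natr; ring.
Qed.

Lemma derXYD p q : derXY (p + q) = derXY p + derXY q.
Proof. by rewrite /derXY raddfD derivD; ring. Qed.

Lemma map_derivM (p q : {poly {poly K}}) :
  map_poly (@deriv K) (p * q) =
  map_poly (@deriv K) p * q + p * map_poly (@deriv K) q.
Proof.
apply/polyP => i; rewrite coef_map coefD !coefM /= raddf_sum -big_split /=.
by apply: eq_bigr => j _; rewrite !coef_map derivM.
Qed.

Lemma derXYM p q : derXY (p * q) = derXY p * q + p * derXY q.
Proof. by rewrite /derXY map_derivM derivM; ring. Qed.

Lemma map_derivC (p : {poly K}) : map_poly (@deriv K) p%:P = (p^`()%R)%:P.
Proof. by rewrite map_polyC. Qed.

Lemma map_derivX : map_poly (@deriv K) 'X = 0.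
Proof.
apply/polyP => i; rewrite coef_map coefX coef0.
by case: (i == 1%N); rewrite /= ?deriv0 // -[1]/(1%:P) derivC.
Qed.

Lemma derXYC (p : {poly K}) : derXY p%:P = (p^`()%R)%:P * 'X.
Proof. by rewrite /derXY map_derivC derivC mul0r addr0. Qed.

Lemma derXY_X : derXY 'X = half_dcubic%:P.
Proof. by rewrite /derXY map_derivX derivX mul0r add0r mul1r. Qed.

Lemma derXYN p : derXY (- p) = - derXY p.
Proof.
by apply/eqP; rewrite -subr_eq0 opprK -derXYD addNr /derXY raddf0 derivC !mul0r addr0.
Qed.

Lemma derXY_eqX : derXY eqX = 0.
Proof.
rewrite /eqX derXYD derXYN derXYC expr2 derXYM derXY_X dcubicE.
by rewrite -mul_polyC polyCM; ring.
Qed.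

Lemma in_qpoly_derXY_mod p :
  in_qpoly eqX (derXY (in_qpoly eqX p : {poly {poly K}})) =
  in_qpoly eqX (derXY p).
Proof.
rewrite /= mk_monic_eqX [in RHS](Pdiv.RingMonic.rdivp_eq eqX_monic p).
rewrite derXYD derXYM derXY_eqX mulr0 addr0 !rmorphD !rmorphM /=.
by rewrite in_qpoly_eqX mulr0 add0r.
Qed.

Lemma dX_in_qpoly p : dX_fun (in_qpoly eqX p) = in_qpoly eqX (derXY p).
Proof. exact: in_qpoly_derXY_mod. Qed.

Fact dXD f g : dX_fun (f + g) = dX_fun f + dX_fun g.
Proof. by rewrite /dX_fun /= derXYD rmorphD. Qed.

Fact dXM f g : dX_fun (f * g) = dX_fun f * g + f * dX_fun g.
Proof.
rewrite -[f in LHS]val_OXK -[g in LHS]val_OXK -rmorphM dX_in_qpoly derXYM.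
by rewrite rmorphD !rmorphM /= !val_OXK.
Qed.

Definition dX : derivation OX := Derivation dXD dXM.

Lemma in_qpolyB p q : in_qpoly eqX (p - q) = in_qpoly eqX p - in_qpoly eqX q.
Proof. exact: rmorphB. Qed.

Lemma in_qpolyC_lin a (p : {poly K}) :
  in_qpoly eqX (a *: p)%:P = cstX a * in_qpoly eqX p%:P.
Proof. by rewrite -mul_polyC polyCM rmorphM. Qed.

Lemma cstX_nat k : cstX k%:R = k%:R.
Proof. by rewrite /cstX !polyC_natr rmorph_nat. Qed.

Lemma in_qpolyC_Xn k : in_qpoly eqX ('X^k)%:P = xX ^+ k.
Proof. by rewrite polyC_exp rmorphXn. Qed.

Lemma yX_sqr : yX ^+ 2 = 4 * xX ^+ 3 - cstX (60 * e4) * xX - cstX (140 * e6).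
Proof.
have in_eqX : in_qpoly eqX eqX = yX ^+ 2 - in_qpoly eqX cubic%:P.
  by rewrite [X in in_qpoly _ X]/eqX rmorphB rmorphXn.
apply/eqP; rewrite -subr_eq0; apply/eqP; rewrite -in_qpoly_eqX in_eqX.
congr (_ - _); rewrite /cubic !polyCB !in_qpolyB !in_qpolyC_lin in_qpolyC_Xn.
by rewrite cstX_nat.
Qed.

Lemma dX_x : dX xX = yX.
Proof. by rewrite /= dX_in_qpoly derXYC derivX mul1r. Qed.

Lemma dX_y : dX yX = 6 * xX ^+ 2 - cstX (30 * e4).
Proof.
rewrite /= dX_in_qpoly derXY_X /half_dcubic polyCB in_qpolyB in_qpolyC_lin.
by rewrite in_qpolyC_Xn cstX_nat.
Qed.

Lemma dX_cst c : dX (cstX c) = 0.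
Proof. by rewrite /= dX_in_qpoly derXYC derivC mul0r raddf0. Qed.

Lemma OX_ind (Q : OX -> Prop) : (forall c, Q (cstX c)) -> Q xX -> Q yX ->
  (forall f g, Q f -> Q g -> Q (f + g)) ->
  (forall f g, Q f -> Q g -> Q (f * g)) -> forall f, Q f.
Proof.
move=> Qc Qx Qy QD QM f; rewrite -[f]val_OXK.
have QP (p : {poly K}) : Q (in_qpoly eqX p%:P).
  elim/poly_ind: p => [|p c IH]; first exact: (Qc 0).
  by rewrite polyCD polyCM in_qpolyD in_qpolyM; apply: QD; [apply: QM | exact: Qc].
elim/poly_ind: (polyn f) => [|p c IH].
  by rewrite -[0]/(0%:P); exact: QP.
by rewrite in_qpolyD in_qpolyM; apply: QD; [apply: QM | exact: QP].
Qed.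

(* [dX] is the universal K-linear derivation on O(X): the module of Kaehler
   differentials of X is free on alpha. *)
Lemma kaehler_differentials (N : lmodType OX) (delta : OX -> N) :
    (2 : K) != 0 -> nonsingular e4 e6 ->
    (forall f g, delta (f + g) = delta f + delta g) ->
    (forall f g, delta (f * g) = g *: delta f + f *: delta g) ->
    (forall c, delta (cstX c) = 0) ->
  exists! n : N, forall f, delta f = dX f *: n.
Proof.
move=> n2 nD dD dM dC.
have cstM a b : cstX (a * b) = cstX a * cstX b.
  by rewrite /cstX !polyCM rmorphM.
have cstB a b : cstX (a - b) = cstX a - cstX b.
  by rewrite /cstX !polyCB rmorphB.
have cst1 : cstX 1 = 1 by rewrite /cstX rmorph1.
have cstn k : cstX k%:R = k%:R.
  by rewrite /cstX -[k%:R]/(k%:R : K) !polyC_natr rmorph_nat.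
have cstX2 a n : cstX (a ^+ n) = cstX a ^+ n.
  by rewrite /cstX !rmorphXn.
set D := (60 * e4) ^+ 3 - 27 * (140 * e6) ^+ 2 in nD *.
pose H := 6 * xX ^+ 2 - cstX (30 * e4).
pose l := 3 * cstX (140 * e6) - 2 * cstX (60 * e4) * xX.
pose a := cstX D^-1 * 9 * l * yX.
pose b := cstX D^-1 * 2 * (- 3 * xX * l - cstX (60 * e4) ^+ 2).
have cD : cstX D = cstX (60 * e4) ^+ 3 - 27 * cstX (140 * e6) ^+ 2.
  by rewrite /D cstB (cstX2 (60 * e4)) (cstM 27) cstn cstX2.
have c60 : cstX (60 * e4) = 2 * cstX (30 * e4).
  by rewrite -cstn -cstM; congr cstX; ring.
have bez : a * yX + b * H = 1.
  have -> : a * yX = cstX D^-1 * 9 * l * yX ^+ 2 by rewrite /a; ring.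
  transitivity (cstX D^-1 * cstX D); last by rewrite -cstM mulVf.
  by rewrite yX_sqr cD /b /H /l c60; ring.
have yy : yX *: delta yX = H *: delta xX.
  have d0 : delta (yX ^+ 2) = delta (4 * xX ^+ 3 - cstX (60 * e4) * xX - cstX (140 * e6)).
    by rewrite yX_sqr.
  have dN f : delta (- f) = - delta f.
    have : delta (f - f) = 0 by rewrite subrr -(dC 0) /cstX !rmorph0.
    by rewrite dD => /eqP; rewrite addrC addr_eq0 => /eqP.
  have dcM c f : delta (cstX c * f) = cstX c *: delta f.
    by rewrite dM dC scaler0 add0r.
  have dy2 : delta (yX ^+ 2) = (2 * yX) *: delta yX.
    by rewrite expr2 dM -scalerDl; congr (_ *: _); ring.
  have dx3 : delta (xX ^+ 3) = (3 * xX ^+ 2) *: delta xX.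
    rewrite [xX ^+ 3]exprS dM expr2 dM -scalerDl scalerA -scalerDl.
    by congr (_ *: _); ring.
  have h2 : (2 : OX) *: (yX *: delta yX - H *: delta xX) = 0.
    rewrite scalerBr !scalerA -dy2 d0 !dD !dN dC oppr0 addr0 -[4%:R]cstn.
    rewrite !dcM dx3 scalerA -scalerBl -scalerBl cstn c60 /H.
    rewrite -[RHS](scale0r (delta xX)); congr (_ *: _); ring.
  apply/eqP; rewrite -subr_eq0 -[_ - _]scale1r -cst1 -(mulVf n2) cstM cstn.
  by rewrite -scalerA h2 scaler0.
exists (a *: delta xX + b *: delta yX); split.
  have dx : delta xX = yX *: (a *: delta xX + b *: delta yX).
    rewrite scalerDr !scalerA [yX * b]mulrC -[(b * _) *: _]scalerA yy.
    by rewrite scalerA -scalerDl [yX * a]mulrC bez scale1r.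
  have dy : delta yX = H *: (a *: delta xX + b *: delta yX).
    rewrite scalerDr !scalerA [H * a]mulrC -[(a * _) *: _]scalerA -yy.
    by rewrite scalerA -scalerDl [H * b]mulrC bez scale1r.
  set n := (_ + _) in dx dy *.
  elim/OX_ind => [c|||f g IHf IHg|f g IHf IHg].
  - by rewrite dC dX_cst scale0r.
  - by rewrite dX_x.
  - by rewrite dX_y.
  - by rewrite dD IHf IHg derD scalerDl.
  - by rewrite dM IHf IHg derM !scalerA -scalerDl mulrC.
move=> n Hn; rewrite (Hn xX) (Hn yX) dX_x dX_y !scalerA -scalerDl.
by rewrite bez scale1r.
Qed.

(* Value of a regular function at the point (s, t) of X over an extension. *)
Definition evalX (L : fieldType) (iota : K -> L) (f : OX) (s t : L) : L :=
  (map_poly (map_poly iota) (f : {poly {poly K}})).[t%:P].[s].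

End Curve.

(* Derivatives are complex derivatives when C is R[i].  z = int_oo alpha is the
   local coordinate at infinity with dz = alpha = dx/y, i.e. y = dx/dz; x has a
   double pole there.  On a punctured disc |z| < r, x = wp z, y = wp' z. *)
Record abel_jacobi (C : numFieldType) (g4 g6 : C) (r : C) (wp : C -> C)
    (e : nat -> C) : Prop := AbelJacobi {
  aj_radius : 0 < r;
  aj_derivable : forall z, 0 < `|z| < r -> derivable wp z 1;
  aj_curve : forall z, 0 < `|z| < r ->
    derive1 wp z ^+ 2 = 4 * wp z ^+ 3 - 60 * g4 * wp z - 140 * g6;
  aj_laurent : forall z, 0 < `|z| < r ->
    z ^- 2 + \sum_(1 <= n < N) (2 * n + 1)%N%:R * e (2 * n + 2)%N * z ^+ (2 * n)%N
      @[N --> \oo] --> wp z;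
  aj_e4 : e 4%N = g4;
  aj_e6 : e 6%N = g6;
  aj_e2 : e 2%N = 0;
  aj_odd : forall n, odd n -> e n = 0
}.

(* A regular function is determined by its values on the punctured disc. *)
Definition kzb_functions (K : fieldType) (e4 e6 : K) (C : numFieldType)
    (iota : K -> C) (r : C) (wp : C -> C) (e : nat -> C)
    (P : nat -> OX e4 e6) : Prop :=
  forall k, (2 <= k)%N -> forall z, 0 < `|z| < r ->
    evalX iota (P k) (wp z) (derive1 wp z) =
    (-1) ^+ k / (k.-1)`!%:R * derive1n (k - 2)%N wp z - e k.

Section Connections.
Variables (O : comNzRingType) (d : derivation O).

(* A quasi-coherent module with connection on the affine curve with ring of
   functions O, whose differentials are free on a form alpha dual to d: the
   connection is s |-> (nabla s) alpha.  On a curve every connection is flat. *)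
Record connection := Connection {
  bundle :> lmodType O;
  nabla : bundle -> bundle;
  nablaD : forall s t, nabla (s + t) = nabla s + nabla t;
  nabla_leibniz : forall (f : O) s, nabla (f *: s) = d f *: s + f *: nabla s
}.

Definition horizontal (E F : connection) (phi : E -> F) : Prop :=
  forall s, phi (nabla s) = nabla (phi s).

Section Trivial.
Variable r : nat.

Definition trivial_nabla (s : {ffun 'I_r -> O^o}) : {ffun 'I_r -> O^o} :=
  [ffun i => d (s i)].

Fact trivial_nablaD s t :
  trivial_nabla (s + t) = trivial_nabla s + trivial_nabla t.
Proof. by apply/ffunP => i; rewrite !ffunE derD. Qed.

Fact trivial_nabla_leibniz (f : O) s :
  trivial_nabla (f *: s) = d f *: s + f *: trivial_nabla s.
Proof. by apply/ffunP => i; rewrite !ffunE [d _]derM. Qed.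

Definition trivial_connection : connection :=
  Connection trivial_nablaD trivial_nabla_leibniz.

End Trivial.

Definition short_exact (E' E E'' : connection) (i : {linear E' -> E})
    (p : {linear E -> E''}) : Prop :=
  [/\ horizontal i, horizontal p, injective i,
      forall t, exists s, p s = t
    & forall s, p s = 0 <-> exists s', i s' = s].

(* Local freeness is not required in [connection]: a unipotent one is free of
   finite rank, X being affine. *)
Inductive unipotent : connection -> Prop :=
| unipotent_trivial r : unipotent (trivial_connection r)
| unipotent_extension (E' E E'' : connection) (i : {linear E' -> E})
    (p : {linear E -> E''}) :
    short_exact i p -> unipotent E' -> unipotent E'' -> unipotent E.

Record proconnection := ProConnection {
  level :> nat -> connection;
  trans : forall m n, (m <= n)%N -> {linear level n -> level m};
  trans_horizontal : forall m n (le_mn : (m <= n)%N),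
    horizontal (trans le_mn);
  trans_id : forall n (le_nn : (n <= n)%N) s, trans le_nn s = s;
  trans_comp : forall l m n (le_lm : (l <= m)%N) (le_mn : (m <= n)%N)
    (le_ln : (l <= n)%N) s, trans le_lm (trans le_mn s) = trans le_ln s
}.

Variables (K : fieldType) (ev : O -> K).

(* Equality in the fibre E / m E of E at the K-point with evaluation map ev,
   m being the kernel of ev.  An element of the fibre is given by any of its
   representatives in E. *)
Definition fibre_eq (E : connection) (s t : E) : Prop :=
  exists n (f : 'I_n -> O) (u : 'I_n -> E),
    (forall i, ev (f i) = 0) /\ s - t = \sum_i f i *: u i.

(* A morphism from a pro-object E to a constant object F is an element of the
   direct limit of the Hom (E n, F). *)
Definition universal_pointed_unipotent (E : proconnection)
    (v0 : forall n, E n) : Prop :=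
  [/\ forall n, unipotent (E n),
      forall m n (le_mn : (m <= n)%N),
        fibre_eq (trans E le_mn (v0 n)) (v0 m)
    & forall F : connection, unipotent F -> forall v : F,
      (exists n (phi : {linear E n -> F}),
         horizontal phi /\ fibre_eq (phi (v0 n)) v)
      /\
      (forall m n (phi : {linear E m -> F}) (psi : {linear E n -> F}),
         horizontal phi -> fibre_eq (phi (v0 m)) v ->
         horizontal psi -> fibre_eq (psi (v0 n)) v ->
         exists k (le_mk : (m <= k)%N) (le_nk : (n <= k)%N),
           forall s : E k, phi (trans E le_mk s) = psi (trans E le_nk s))].

End Connections.

Arguments universal_pointed_unipotent {O d K} ev E v0.

(* O<<A, B>>: a series is the function sending a word to its coefficient; the
   letter A is false and B is true. *)
Section NoncommutativeSeries.
Variable O : comNzRingType.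

Definition ncseries := seq bool -> O.

Definition nc1 : ncseries := fun w => (w == [::])%:R.
Definition ncA : ncseries := fun w => (w == [:: false])%:R.
Definition ncB : ncseries := fun w => (w == [:: true])%:R.

Definition ncmul (f g : ncseries) : ncseries :=
  fun w => \sum_(i < (size w).+1) f (take i w) * g (drop i w).

Definition nc_ad (f g : ncseries) : ncseries :=
  fun w => ncmul f g w - ncmul g f w.

(* The sum of a family (F_k) of series in which F_k has no word of length
   < k; this is the case of all families below. *)
Definition ncsum (F : nat -> ncseries) : ncseries :=
  fun w => \sum_(k < (size w).+1) F k w.

Lemma ncsum_stable (F : nat -> ncseries) w N :
  (forall k u, (size u < k)%N -> F k u = 0) ->
  (size w < N)%N -> \sum_(k < N) F k w = ncsum F w.
Proof.
move=> F0 ltN; rewrite /ncsum -!(big_mkord xpredT (fun k => F k w)).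
rewrite (@big_cat_nat _ _ _ (size w).+1) //= [X in _ + X]big_nat.
rewrite [X in _ + X]big1 ?addr0 // => k /andP[lek _]; exact: F0.
Qed.

Lemma ncmul_order (f g : ncseries) a b w :
  (forall u, (size u < a)%N -> f u = 0) ->
  (forall u, (size u < b)%N -> g u = 0) ->
  (size w < a + b)%N -> ncmul f g w = 0.
Proof.
move=> f0 g0 lt; apply: big1 => i _.
have [lti|lei] := ltnP i a.
  by rewrite f0 ?mul0r // size_take_min (leq_ltn_trans (geq_minl _ _)).
rewrite [X in _ * X]g0 ?mulr0 // size_drop ltn_subLR //.
  by rewrite (leq_trans lt) // leq_add2r.
by rewrite -ltnS ltn_ord.
Qed.

Lemma iter_ad_order (f : ncseries) a k w :
  (forall u, (size u < a)%N -> f u = 0) ->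
  (size w < k + a)%N -> iter k (nc_ad ncB) f w = 0.
Proof.
move=> f0; elim: k w => [|k IH] w; first exact: f0.
have B0 u : (size u < 1)%N -> ncB u = 0 by case: u.
rewrite addSn => lt; rewrite iterS /nc_ad.
by rewrite (ncmul_order B0 IH) // (ncmul_order IH B0) ?subrr // addn1.
Qed.

End NoncommutativeSeries.

Section KZB.
Variables (K : fieldType) (e4 e6 : K) (P : nat -> OX e4 e6).
Notation O := (OX e4 e6).

(* - sum_(k >= 2) (-1)^k P_k ad_B^k / k *)
Definition kzb_exponent (f : ncseries O) : ncseries O :=
  fun w => - ncsum (fun k u => if (k < 2)%N then 0 else
    cstX e4 e6 ((-1) ^+ k / k%:R) * P k * iter k (nc_ad (@ncB O)) f u) w.

Definition ncexp (T : ncseries O -> ncseries O) (f : ncseries O) : ncseries O :=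
  ncsum (fun m u => cstX e4 e6 (m`!%:R^-1) * iter m T f u).

Lemma kzb_exponent_stable (f : ncseries O) w N : (size w < N)%N ->
  kzb_exponent f w =
  - \sum_(2 <= k < N)
      cstX e4 e6 ((-1) ^+ k / k%:R) * P k * iter k (nc_ad (@ncB O)) f w.
Proof.
move=> ltN; rewrite /kzb_exponent; congr (- _); rewrite -(ncsum_stable _ ltN).
  rewrite -(big_mkord xpredT (fun k => if (k < 2)%N then 0 else
    cstX e4 e6 ((-1) ^+ k / k%:R) * P k * iter k (nc_ad (@ncB O)) f w)).
  have [le2|lt2] := leqP 2 N.
    rewrite (@big_cat_nat _ _ _ 2) //= big_nat big1 ?add0r.
      by rewrite !big_nat; apply: eq_bigr => k /andP[]; rewrite leqNgt => /negbTE->.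
    by move=> k /andP[_ ->].
  rewrite [RHS]big_geq ?(ltnW lt2) // big_nat big1 // => k /andP[_ ltk].
  by rewrite (leq_trans ltk) // ltnW.
move=> k u ltu; case: ifP => // _.
by rewrite (iter_ad_order (a := 0)) ?mulr0 // addn0.
Qed.

Lemma iter_kzb_exponent_order m w :
  (size w < m + 1)%N -> iter m kzb_exponent (@ncA O) w = 0.
Proof.
elim: m w => [|m IH] w; first by case: w.
move=> lt; rewrite iterS (kzb_exponent_stable _ (ltnSn _)).
rewrite big_nat big1 ?oppr0 // => k /andP[le2 _].
rewrite (iter_ad_order IH) ?mulr0 // (leq_trans lt) // addSn -add1n leq_add2r.
exact: ltnW.
Qed.

Lemma ncexp_kzb_stable w N : (size w < N)%N ->
  ncexp kzb_exponent (@ncA O) w =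
  \sum_(m < N) cstX e4 e6 (m`!%:R^-1) * iter m kzb_exponent (@ncA O) w.
Proof.
move=> ltN; rewrite /ncexp -(ncsum_stable _ ltN) // => k u ltu.
by rewrite iter_kzb_exponent_order ?mulr0 // addn1 ltnW.
Qed.

(* omega_KZB = (omega_kzb) alpha; recall that beta = x alpha. *)
Definition omega_kzb : ncseries O :=
  fun w => xX e4 e6 * ncB O w + ncexp kzb_exponent (@ncA O) w.

Definition nabla_kzb (F : ncseries O) : ncseries O :=
  fun w => dX e4 e6 (F w) - ncmul omega_kzb F w.

(* Truncation by the words of length > n. *)
Definition nctrunc n (F : ncseries O) : {ffun n.-bseq bool -> O^o} :=
  [ffun w : n.-bseq bool => F w].

Definition ncext n (s : {ffun n.-bseq bool -> O^o}) : ncseries O :=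
  fun w => oapp s 0 (insub w).

Definition nabla_kzb_trunc n (s : {ffun n.-bseq bool -> O^o}) :=
  nctrunc n (nabla_kzb (ncext s)).

Lemma ncextE n (s : {ffun n.-bseq bool -> O^o}) (w : n.-bseq bool) :
  ncext s w = s w.
Proof. by rewrite /ncext valK. Qed.

Lemma nabla_kzb_local n (F G : ncseries O) :
  (forall w, (size w <= n)%N -> F w = G w) ->
  forall w, (size w <= n)%N -> nabla_kzb F w = nabla_kzb G w.
Proof.
move=> FG w lew; rewrite /nabla_kzb FG //; congr (_ - _).
by apply: eq_bigr => i _; rewrite FG // size_drop (leq_trans _ lew) ?leq_subr.
Qed.

Lemma ncext_trunc n F w : (size w <= n)%N -> ncext (nctrunc n F) w = F w.
Proof. by move=> lew; rewrite /ncext insubT /= ffunE. Qed.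

Lemma nctrunc_nabla n F :
  nctrunc n (nabla_kzb F) = nabla_kzb_trunc (nctrunc n F).
Proof.
apply/ffunP => w; rewrite !ffunE.
apply: (@nabla_kzb_local n) (size_bseq w) => u leu.
by rewrite ncext_trunc.
Qed.

Fact nabla_kzb_truncD n (s t : {ffun n.-bseq bool -> O^o}) :
  nabla_kzb_trunc (s + t) = nabla_kzb_trunc s + nabla_kzb_trunc t.
Proof.
have extD u : ncext (s + t) u = ncext s u + ncext t u.
  by rewrite /ncext; case: insubP => [w _ _|_] /=; rewrite ?ffunE ?addr0.
apply/ffunP => w; rewrite !ffunE /nabla_kzb extD derD.
have -> : ncmul omega_kzb (ncext (s + t)) w =
          ncmul omega_kzb (ncext s) w + ncmul omega_kzb (ncext t) w.
  by rewrite /ncmul -big_split; apply: eq_bigr => i _; rewrite extD mulrDr.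
by rewrite opprD addrACA.
Qed.

Fact nabla_kzb_trunc_leibniz n (f : O) (s : {ffun n.-bseq bool -> O^o}) :
  nabla_kzb_trunc (f *: s) = dX e4 e6 f *: s + f *: nabla_kzb_trunc s.
Proof.
have extZ u : ncext (f *: s) u = f * ncext s u.
  by rewrite /ncext; case: insubP => [w _ _|_] /=; rewrite ?ffunE ?mulr0.
apply/ffunP => w; rewrite !ffunE /nabla_kzb extZ derM -ncextE.
have -> : ncmul omega_kzb (ncext (f *: s)) w = f * ncmul omega_kzb (ncext s) w.
  by rewrite /ncmul mulr_sumr; apply: eq_bigr => i _; rewrite extZ mulrCA.
by rewrite -addrA -mulrBr.
Qed.

Definition kzb_level n : connection (dX e4 e6) :=
  Connection (@nabla_kzb_truncD n) (@nabla_kzb_trunc_leibniz n).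

Definition kzb_trans_fun m n (le_mn : (m <= n)%N) (s : kzb_level n) :
    kzb_level m :=
  [ffun w : m.-bseq bool => (s : {ffun _ -> _}) (widen_bseq le_mn w)].

Fact kzb_trans_linear m n (le_mn : (m <= n)%N) : linear (kzb_trans_fun le_mn).
Proof. by move=> f s t; apply/ffunP => w; rewrite !ffunE. Qed.

HB.instance Definition _ m n (le_mn : (m <= n)%N) :=
  GRing.isLinear.Build O (kzb_level n) (kzb_level m) *:%R
    (kzb_trans_fun le_mn) (kzb_trans_linear le_mn).

Definition kzb_trans m n (le_mn : (m <= n)%N) :
  {linear kzb_level n -> kzb_level m} := kzb_trans_fun le_mn.

Fact kzb_trans_trunc m n (le_mn : (m <= n)%N) F :
  kzb_trans le_mn (nctrunc n F) = nctrunc m F.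
Proof. by apply/ffunP => w; rewrite !ffunE. Qed.

Fact kzb_trans_horizontal m n (le_mn : (m <= n)%N) :
  horizontal (kzb_trans le_mn).
Proof.
move=> s; have sE : s = nctrunc n (ncext s).
  by apply/ffunP => w; rewrite ffunE ncextE.
by rewrite sE /= -nctrunc_nabla !kzb_trans_trunc -nctrunc_nabla.
Qed.

Fact kzb_trans_id n (le_nn : (n <= n)%N) s : kzb_trans le_nn s = s.
Proof. by apply/ffunP => w; rewrite ffunE widen_bseq_id. Qed.

Fact kzb_trans_comp l m n (le_lm : (l <= m)%N) (le_mn : (m <= n)%N)
  (le_ln : (l <= n)%N) s :
  kzb_trans le_lm (kzb_trans le_mn s) = kzb_trans le_ln s.
Proof.
apply/ffunP => w; rewrite !ffunE; congr (s _); exact: val_inj.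
Qed.

(* (O<<A, B>>, nabla_KZB) as the inverse limit of its truncations. *)
Definition kzb_connection : proconnection (dX e4 e6) :=
  ProConnection kzb_trans_horizontal kzb_trans_id kzb_trans_comp.

Definition kzb_marking n : kzb_connection n := nctrunc n (@nc1 O).

End KZB.

(* Main.v *)
Require Import Defs.
From HB Require Import structures.
From mathcomp Require Import all_boot all_order all_algebra complex.
From mathcomp Require Import all_classical all_reals all_analysis.
From mathcomp Require Import ring.
Set Implicit Arguments.
Unset Strict Implicit.
Unset Printing Implicit Defensive.
Import Order.TTheory GRing.Theory Num.Theory.
Local Open Scope ring_scope.

(* On X every regular function is, up to an exact one, of the form c1 + c2 x
   with unique constants c1 and c2, and the functions with zero derivative are
   constant.  The coefficients of omega_KZB at the words of length at most 1 are
   0, 1 (at A) and x (at B), so multiplication by the letters A and B hits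
   exactly the two classes alpha and x alpha of H^1(X): over the tower of
   truncations every class in Ext^1 to a trivial connection dies at the next
   level, and a horizontal map to a trivial connection kills all nonempty words.
   Both facts, and with them existence and uniqueness of horizontal maps with a
   given marking, pass to iterated extensions, because unipotent connections are
   projective modules. *)

(** * Linear algebra: factorizations, liftings and free modules *)

Section LinearAlgebra.
Variable O : comNzRingType.

Definition linear_pack (U V : lmodType O) (f : U -> V) (Hf : linear f) :
  {linear U -> V} := HB.pack f (GRing.isLinear.Build O U V *:%R f Hf).

(** Preimages under an injective map are unique, so any choice of them is linear. *)
Lemma linear_factor (U V W : lmodType O) (i : {linear U -> V})
    (f : {linear W -> V}) :
  injective i -> (forall s, exists u, i u = f s) ->
  exists g : {linear W -> U}, forall s, i (g s) = f s.
Proof.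
move=> inj_i /boolp.choice [g gE].
have g_lin : linear g.
  by move=> a s t; apply: inj_i; rewrite linearP !gE linearP.
by exists (linear_pack g_lin).
Qed.

Definition projective (M : lmodType O) : Prop :=
  forall (U V : lmodType O) (q : {linear U -> V}) (f : {linear M -> V}),
    (forall v, exists u, q u = v) ->
  exists g : {linear M -> U}, forall s, q (g s) = f s.

Section FreeModule.
Variable I : finType.

Definition ffun_delta (i : I) : {ffun I -> O^o} := [ffun j => (j == i)%:R].

Lemma ffun_deltaE (s : {ffun I -> O^o}) :
  s = \sum_i (s i : O) *: ffun_delta i.
Proof.
apply/ffunP => j; rewrite sum_ffunE (bigD1 j) //= !ffunE eqxx.
rewrite big1 => [|i neq_ij]; first by rewrite addr0 [RHS]mulr1.
by rewrite !ffunE eq_sym (negbTE neq_ij) [LHS]mulr0.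
Qed.

Lemma ffun_comb_linear (M : lmodType O) (a : I -> M) :
  linear (fun s : {ffun I -> O^o} => \sum_i (s i : O) *: a i).
Proof.
move=> c s t; rewrite scaler_sumr -big_split /=; apply: eq_bigr => i _.
by rewrite !ffunE scalerDl scalerA.
Qed.

Definition ffun_comb (M : lmodType O) (a : I -> M) :=
  linear_pack (ffun_comb_linear a).

Lemma ffun_comb_delta (M : lmodType O) (a : I -> M) i :
  ffun_comb a (ffun_delta i) = a i.
Proof.
rewrite /= (bigD1 i) //= ffunE eqxx scale1r big1 ?addr0 // => j neq_ji.
by rewrite ffunE (negbTE neq_ji) scale0r.
Qed.

Lemma linear_ffunE (M : lmodType O) (f : {linear {ffun I -> O^o} -> M}) s :
  f s = \sum_i (s i : O) *: f (ffun_delta i).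
Proof.
rewrite {1}(ffun_deltaE s) linear_sum; apply: eq_bigr => i _.
exact: linearZ.
Qed.

Lemma projective_ffun : projective {ffun I -> O^o}.
Proof.
move=> U V q f q_surj.
have [u uE] := boolp.choice (fun i => q_surj (f (ffun_delta i))).
exists (ffun_comb u) => s; rewrite (linear_ffunE f) /= linear_sum.
by apply: eq_bigr => i _; rewrite linearZ /= uE.
Qed.

End FreeModule.

Section CoordinateSubmodule.
Variables (I : finType) (r : nat) (f : 'I_r -> I).
Hypothesis f_inj : injective f.

Definition coordinate_incl : {linear {ffun 'I_r -> O^o} -> {ffun I -> O^o}} :=
  ffun_comb (fun k => ffun_delta (f k)).

Lemma coordinate_inclE t k : coordinate_incl t (f k) = t k.
Proof.
rewrite /= sum_ffunE (bigD1 k) //= !ffunE eqxx big1 ?addr0; first exact: mulr1.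
by move=> j neq_jk; rewrite !ffunE inj_eq // eq_sym (negbTE neq_jk) [LHS]mulr0.
Qed.

Lemma coordinate_incl_out t u : u \notin codom f -> coordinate_incl t u = 0.
Proof.
move=> u_out; rewrite /= sum_ffunE big1 // => k _; rewrite !ffunE.
by case: eqP => [uE|_]; [rewrite uE codom_f in u_out | exact: mulr0].
Qed.

Lemma coordinate_incl_inj : injective coordinate_incl.
Proof. by move=> t t' tt'; apply/ffunP => k; rewrite -!coordinate_inclE tt'. Qed.

Lemma coordinate_incl_image (s : {ffun I -> O^o}) :
  (forall u, u \notin codom f -> s u = 0) <-> exists t, coordinate_incl t = s.
Proof.
split=> [s0|[t <-] u]; last exact: coordinate_incl_out.
exists [ffun k => s (f k)]; apply/ffunP => u.
have [/codomP[k ->]|u_out] := boolP (u \in codom f).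
  by rewrite coordinate_inclE ffunE.
by rewrite s0 // coordinate_incl_out.
Qed.

End CoordinateSubmodule.
End LinearAlgebra.

(** * Module splittings of extensions of connections *)

Section Connections.
Variables (O : comNzRingType) (d : derivation O).
Implicit Types E F : connection d.

Lemma der0 : d 0 = 0.
Proof. by apply: (addrI (d 0)); rewrite -derD !addr0. Qed.

Lemma derN f : d (- f) = - d f.
Proof. by apply/eqP; rewrite -addr_eq0 -derD addNr der0. Qed.

Lemma nabla0 E : nabla (0 : E) = 0.
Proof. by rewrite -[0 in LHS](scale0r 0) nabla_leibniz scaler0 scale0r addr0. Qed.

Lemma nablaN E (s : E) : nabla (- s) = - nabla s.
Proof. by apply/eqP; rewrite -addr_eq0 -nablaD addNr nabla0. Qed.

Lemma nablaB E (s t : E) : nabla (s - t) = nabla s - nabla t.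
Proof. by rewrite nablaD nablaN. Qed.

(** The splitting is one of modules only: [sigma] lifts the identity and [rho] is [id - sigma p],
    which lands in the kernel of [p]; neither need be horizontal. *)
Lemma short_exact_split (E' E E'' : connection d) (i : {linear E' -> E})
    (p : {linear E -> E''}) :
  short_exact i p -> projective E'' ->
  exists (sigma : {linear E'' -> E}) (rho : {linear E -> E'}),
    [/\ forall t, p (sigma t) = t, forall s, rho (i s) = s
      & forall s, s = i (rho s) + sigma (p s)].
Proof.
case=> _ _ inj_i p_surj exact_p projE''.
have [sigma sigmaE] := projE'' _ _ p idfun p_surj.
have [s|rho rhoE] := @linear_factor _ _ _ _ i (idfun \- (sigma \o p)) inj_i.
  by apply/exact_p; rewrite linearB /= sigmaE subrr.
exists sigma, rho; split => // [s|s]; last by rewrite rhoE /= subrK.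
apply: inj_i; rewrite rhoE /=.
by have/exact_p-> : exists s', i s' = i s; [exists s | rewrite linear0 subr0].
Qed.

(** Trivial connections are free, and as a module an extension of projectives is a direct sum, so
    lifts on the two summands add up. *)
Lemma unipotent_projective E : unipotent E -> projective E.
Proof.
elim=> {E} [r|E' E E'' i p ses _ projE' _ projE'']; first exact: projective_ffun.
have [sigma [rho [_ _ splitE]]] := short_exact_split ses projE''.
move=> U V q f q_surj.
have [g' g'E] := projE' _ _ q (f \o i) q_surj.
have [g'' g''E] := projE'' _ _ q (f \o sigma) q_surj.
exists ((g' \o rho) \+ (g'' \o p)) => s.
by rewrite linearD /= g'E g''E /= -linearD -splitE.
Qed.

End Connections.

(** * The fibre at the base point *)

Section Fibre.
Variables (O : comNzRingType) (d : derivation O) (K : fieldType) (ev : O -> K).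
Implicit Types E F : connection d.

Definition fibre_null E (t : E) : Prop :=
  exists n (f : 'I_n -> O) (u : 'I_n -> E),
    (forall i, ev (f i) = 0) /\ t = \sum_i f i *: u i.

Lemma fibre_null_subproof E (s t : E) : fibre_null (s - t) = fibre_eq ev s t.
Proof. by []. Qed.

Lemma fibre_null0 E : fibre_null (0 : E).
Proof. by exists 0, (fun=> 0), (fun=> 0); split=> [[]//|]; rewrite big_ord0. Qed.

Lemma fibre_eq_refl E (s : E) : fibre_eq ev s s.
Proof. by rewrite -fibre_null_subproof subrr; exact: fibre_null0. Qed.

Lemma fibre_nullD E (s t : E) :
  fibre_null s -> fibre_null t -> fibre_null (s + t).
Proof.
move=> [m [f [u [f0 ->]]]] [n [g [w [g0 ->]]]].
exists (m + n)%N, 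
  (fun k => match fintype.split k with inl i => f i | inr j => g j end),
  (fun k => match fintype.split k with inl i => u i | inr j => w j end); split.
  by move=> k; case: fintype.split.
by rewrite big_split_ord; congr (_ + _); apply: eq_bigr => i _;
  [rewrite (unsplitK (inl i)) | rewrite (unsplitK (inr i))].
Qed.

Lemma fibre_null_linear E F (phi : {linear E -> F}) t :
  fibre_null t -> fibre_null (phi t).
Proof.
move=> [n [f [u [f0 ->]]]]; exists n, f, (phi \o u); split=> //.
by rewrite linear_sum; apply: eq_bigr => i _; rewrite linearZ.
Qed.

Lemma fibre_nullN E (t : E) : fibre_null t -> fibre_null (- t).
Proof. exact: (@fibre_null_linear E E (-%R)). Qed.

Lemma fibre_nullB E (s t : E) :
  fibre_null s -> fibre_null t -> fibre_null (s - t).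
Proof. by move=> s0 t0; apply: fibre_nullD => //; apply: fibre_nullN. Qed.

Lemma fibre_null_lift E F (p : {linear E -> F}) t :
  (forall v, exists u, p u = v) -> fibre_null t ->
  exists2 s, fibre_null s & p s = t.
Proof.
move=> p_surj [n [f [u [f0 ->]]]].
have [w wE] := boolp.choice (fun i => p_surj (u i)).
exists (\sum_i f i *: w i); first by exists n, f, w.
by rewrite linear_sum; apply: eq_bigr => i _; rewrite linearZ /= wE.
Qed.

End Fibre.

(** * Deviation from horizontality *)

Section Horizontal.
Variables (O : comNzRingType) (d : derivation O).

Lemma nabla_sum (F : connection d) (I : finType) (s : I -> F) :
  nabla (\sum_i s i) = \sum_i nabla (s i).
Proof. by apply: (big_morph _ (@nablaD _ _ F)); exact: nabla0. Qed.

Lemma horizontal_comb (F : connection d) r (u : 'I_r -> F) :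
  (forall i, nabla (u i) = 0) ->
  horizontal (ffun_comb u : {linear trivial_connection d r -> F}).
Proof.
move=> u0 t; rewrite /= nabla_sum; apply: eq_bigr => i _.
by rewrite ffunE nabla_leibniz u0 scaler0 addr0.
Qed.

(** The Leibniz terms [d a *: phi s] cancel. The result is the derivative of [phi] for the induced
    connection on the linear maps from [E] to [F]. *)
Fact defect_linear (E F : connection d) (phi : {linear E -> F}) :
  linear (fun s => nabla (phi s) - phi (nabla s)).
Proof.
move=> a s t; rewrite !linearP !nablaD !nabla_leibniz !linearD !linearZ /=.
by rewrite addrACA [X in X + _]addrACA scalerN subrr add0r.
Qed.

Definition defect (E F : connection d) (phi : {linear E -> F}) :=
  linear_pack (defect_linear phi).

End Horizontal.

(** * Reduction of the universal property to trivial connections *)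

Section Criterion.
Variables (O : comNzRingType) (d : derivation O) (K : fieldType) (ev : O -> K).
Variables (E : proconnection d) (v0 : forall n, E n).

Hypothesis unipotent_E : forall n, unipotent (E n).
Hypothesis trans_v0 : forall m n (le_mn : (m <= n)%N),
  fibre_eq ev (trans E le_mn (v0 n)) (v0 m).

(* A defect is a class in Ext^1 of connections from [E n] to [F]: these
   classes die in the colimit over [n]. *)
Definition acyclic (F : connection d) : Prop :=
  forall n (eps : {linear E n -> F}),
    exists m (le_nm : (n <= m)%N) (psi : {linear E m -> F}),
      forall s, eps (trans E le_nm s) = defect psi s.

Definition section_extends (F : connection d) : Prop :=
  forall v : F, exists n (phi : {linear E n -> F}),
    horizontal phi /\ fibre_eq ev (phi (v0 n)) v.

(** The uniqueness half, stated for differences of morphisms: a map out of the pro-object is zero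
    once it is zero at some higher level. *)
Definition section_unique (F : connection d) : Prop :=
  forall n (phi : {linear E n -> F}),
    horizontal phi -> fibre_null ev (phi (v0 n)) ->
    exists m (le_nm : (n <= m)%N), forall s, phi (trans E le_nm s) = 0.

Lemma horizontal_defect (F F' : connection d) (phi : {linear F -> F'}) :
  horizontal phi <-> forall s, defect phi s = 0.
Proof.
split=> phi_hor s; first by rewrite /= phi_hor subrr.
by apply/esym/eqP; rewrite -subr_eq0; apply/eqP; exact: phi_hor.
Qed.

Lemma defect_trans n m (le_nm : (n <= m)%N) (F : connection d)
  (phi : {linear E n -> F}) s :
  defect (phi \o trans E le_nm) s = defect phi (trans E le_nm s).
Proof. by rewrite /= trans_horizontal. Qed.

Lemma defectD (F F' : connection d) (phi psi : {linear F -> F'}) s :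
  defect (phi \+ psi) s = defect phi s + defect psi s.
Proof. by rewrite /= nablaD opprD addrACA. Qed.

Lemma defectB (F F' : connection d) (phi psi : {linear F -> F'}) s :
  defect (phi \- psi) s = defect phi s - defect psi s.
Proof. by rewrite /= nablaB !opprD addrACA. Qed.

Lemma defect_comp (F F' F'' : connection d) (i : {linear F' -> F''})
    (phi : {linear F -> F'}) s :
  horizontal i -> defect (i \o phi) s = i (defect phi s).
Proof. by move=> i_hor; rewrite /= -i_hor -linearB. Qed.

Lemma fibre_null_v0 n m (le_nm : (n <= m)%N) (F : connection d)
  (phi : {linear E n -> F}) :
  fibre_null ev (phi (trans E le_nm (v0 m)) - phi (v0 n)).
Proof. by rewrite -linearB; apply: fibre_null_linear; apply: trans_v0. Qed.

Section Extension.
Variables (E' F E'' : connection d) (i : {linear E' -> F})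
  (p : {linear F -> E''}).
Hypothesis ses : short_exact i p.
Hypotheses (uE' : unipotent E') (uE'' : unipotent E'').

(** The long exact sequence by hand: kill the image of the class in [E''], lift the killing map by
    projectivity, then kill the remainder, which has values in [E'], at a higher level. *)
Lemma acyclic_extension : acyclic E' -> acyclic E'' -> acyclic F.
Proof.
case: (ses) => i_hor p_hor i_inj p_surj exact_p ac' ac'' n eps.
have [m [le_nm [psi'' psi''E]]] := ac'' n (p \o eps).
have [psi psiE] := unipotent_projective (unipotent_E m) psi'' p_surj.
have [s|eps' eps'E] :=
    @linear_factor _ _ _ _ i ((eps \o trans E le_nm) \- defect psi) i_inj.
  apply/exact_p; rewrite linearB /= -[p (eps _)]/((p \o eps) _) psi''E /=.
  by rewrite linearB /= p_hor !psiE subrr.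
have [k [le_mk [psi' psi'E]]] := ac' m eps'.
exists k, (leq_trans le_nm le_mk), ((psi \o trans E le_mk) \+ (i \o psi')).
move=> s; rewrite defectD defect_trans defect_comp // -psi'E eps'E /=.
rewrite (trans_comp _ _ (leq_trans le_nm le_mk)).
by rewrite addrC subrK.
Qed.

(** A linear lift of the map for [E''] has its defect in [E'], where acyclicity removes it. In the
    fibre the marking is then off by an element coming from [E'], which existence for [E']
    corrects. *)
Lemma section_extends_extension :
  acyclic E' -> section_extends E' -> section_extends E'' -> section_extends F.
Proof.
case: (ses) => i_hor p_hor i_inj p_surj exact_p ac' ex' ex'' v.
have [n [phi'' [phi''_hor phi''_v]]] := ex'' (p v).
have [phi phiE] := unipotent_projective (unipotent_E n) phi'' p_surj.
have [s|eps epsE] := @linear_factor _ _ _ _ i (defect phi) i_inj.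
  by apply/exact_p; rewrite linearB /= p_hor !phiE phi''_hor subrr.
have [m [le_nm [psi psiE]]] := ac' n eps.
pose chi : {linear E m -> F} := (phi \o trans E le_nm) \- (i \o psi).
have chi_hor : horizontal chi.
  apply/horizontal_defect => s; rewrite defectB defect_trans defect_comp //.
  by rewrite -psiE epsE subrr.
have pchi_v : fibre_null ev (p (v - chi (v0 m))).
  rewrite linearB /= linearB /= phiE.
  have -> : p (i (psi (v0 m))) = 0 by apply/exact_p; eexists.
  rewrite subr0 -opprB; apply: fibre_nullN.
  have -> : phi'' (trans E le_nm (v0 m)) - p v =
     (phi'' (trans E le_nm (v0 m)) - phi'' (v0 n)) + (phi'' (v0 n) - p v).
    by rewrite addrA subrK.
  by apply: fibre_nullD => //; exact: fibre_null_v0.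
(* The image of [v - chi (v0 m)] in [E''] is zero only in the fibre; subtracting a lift [t], itself
   null in the fibre, moves the difference into [E']. *)
have [t t_null pt] := fibre_null_lift p_surj pchi_v.
have [w iw] : exists w, i w = v - chi (v0 m) - t.
  by apply/exact_p; rewrite linearB /= -pt subrr.
have vE : v = chi (v0 m) + i w + t by rewrite -addrA iw subrK addrC subrK.
have [k [eta [eta_hor eta_w]]] := ex' w.
pose le_m := leq_maxl m k; pose le_k := leq_maxr m k.
exists (maxn m k), ((chi \o trans E le_m) \+ (i \o (eta \o trans E le_k))).
split.
  apply/horizontal_defect => s; rewrite defectD.
  rewrite defect_trans (defect_comp _ _ i_hor) defect_trans.
  by rewrite !(proj1 (horizontal_defect _)) // linear0 addr0.
set N := maxn m k.
have -> : fibre_eq ev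
    (((chi \o trans E le_m) \+ (i \o (eta \o trans E le_k))) (v0 N)) v =
  fibre_null ev ((chi (trans E le_m (v0 N)) - chi (v0 m)) +
   i ((eta (trans E le_k (v0 N)) - eta (v0 k)) + (eta (v0 k) - w)) - t).
  rewrite -fibre_null_subproof; congr fibre_null.
  by rewrite [in RHS]addrA subrK [i (_ - w)]linearB {1}vE opprD addrA opprD addrACA.
apply: fibre_nullB => //; apply: fibre_nullD; first exact: fibre_null_v0.
apply: fibre_null_linear; apply: fibre_nullD => //; exact: fibre_null_v0.
Qed.

Lemma section_unique_extension :
  section_unique E' -> section_unique E'' -> section_unique F.
Proof.
case: (ses) => i_hor p_hor i_inj p_surj exact_p un' un'' n phi phi_hor phi_null.
have [|m [le_nm pphi0]] := un'' n (p \o phi) _ (fibre_null_linear p phi_null).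
  by move=> s; rewrite /= phi_hor p_hor.
have [s|psi psiE] := @linear_factor _ _ _ _ i (phi \o trans E le_nm) i_inj.
  by apply/exact_p; exact: pphi0.
have [sigma [rho [_ rhoK _]]] :=
  short_exact_split ses (unipotent_projective uE'').
have [s||k [le_mk psi0]] := un' m psi.
- by apply: i_inj; rewrite i_hor !psiE /= trans_horizontal phi_hor.
(* The fibre of [E'] injects into that of [F], because the module retraction [rho] preserves nullity
   in the fibre. *)
- rewrite -[psi _]rhoK psiE; apply: fibre_null_linear.
  rewrite /= -[phi _](subrK (phi (v0 n))); apply: fibre_nullD => //.
  exact: fibre_null_v0.
exists k, (leq_trans le_nm le_mk) => s.
by rewrite -(trans_comp le_nm le_mk) -[LHS]psiE psi0 linear0.
Qed.

End Extension.

Hypothesis acyclic_trivial : forall r, acyclic (trivial_connection d r).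
Hypothesis section_extends_trivial :
  forall r, section_extends (trivial_connection d r).
Hypothesis section_unique_trivial :
  forall r, section_unique (trivial_connection d r).

Theorem universal_criterion : universal_pointed_unipotent ev E v0.
Proof.
split=> // F uF v.
(* The three properties are carried together: existence for an extension uses acyclicity of its
   subobject. *)
have [acF [exF unF]] : acyclic F /\ section_extends F /\ section_unique F.
  elim: {v} uF =>
    [r|E' {}F E'' i p ses uE' [ac' [ex' un']] uE'' [ac'' [ex'' un'']]].
    by [].
  split; first exact: (acyclic_extension ses).
  split; first exact: (section_extends_extension ses).
  exact: (section_unique_extension ses).
split; first exact: exF.
move=> m n phi psi phi_hor phi_v psi_hor psi_v.
pose le_m := leq_maxl m n; pose le_n := leq_maxr m n.
pose chi : {linear E (maxn m n) -> F} :=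
  (phi \o trans E le_m) \- (psi \o trans E le_n).
have [||k [le_k chi0]] := unF _ chi.
- apply/horizontal_defect => s; rewrite defectB !defect_trans.
  by rewrite !(proj1 (horizontal_defect _)) // subrr.
- have -> : chi (v0 (maxn m n)) =
     (phi (trans E le_m (v0 _)) - phi (v0 m)) -
     (psi (trans E le_n (v0 _)) - psi (v0 n)) +
     ((phi (v0 m) - v) - (psi (v0 n) - v)).
    have -> : phi (v0 m) - v - (psi (v0 n) - v) = phi (v0 m) - psi (v0 n).
      by rewrite opprB addrA subrK.
    by rewrite addrACA subrK -opprD subrK.
  by apply: fibre_nullD; apply: fibre_nullB => //; exact: fibre_null_v0.
exists k, (leq_trans le_m le_k), (leq_trans le_n le_k) => s.
apply/eqP; rewrite -subr_eq0; apply/eqP; rewrite -[RHS](chi0 s) /=.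
by rewrite (trans_comp _ _ (leq_trans le_m le_k))
  (trans_comp _ _ (leq_trans le_n le_k)).
Qed.

End Criterion.

(** * De Rham cohomology of the affine curve *)

Section DeRham.
Variables (K : fieldType) (e4 e6 : K).
Local Notation O := (OX e4 e6).
Local Notation cub := (cubic e4 e6).
Implicit Types p q : {poly K}.

(** The normal form [p + q y]: functions on [X] are free over [K[x]] on 1 and [y]. *)
Definition mkX p q : O := in_qpoly (eqX e4 e6) (p%:P + q%:P * 'X).

Lemma size_mkX p q :
  (size (p%:P + q%:P * 'X : {poly {poly K}})%R < size (mk_monic (eqX e4 e6)))%N.
Proof.
rewrite mk_monic_eqX size_eqX ltnS (leq_trans (size_polyD _ _)) // geq_max.
rewrite (leq_trans (size_polyC_leq1 _)) //=.
rewrite (leq_trans (size_polyMleq _ _)) // size_polyX addn2 /= ltnS.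
exact: size_polyC_leq1.
Qed.

Lemma mkX_surj (f : O) : exists p q, f = mkX p q.
Proof.
exists (f : {poly _})`_0, (f : {poly _})`_1.
rewrite -[LHS]val_OXK; congr in_qpoly; apply/polyP => k.
have size_f : (size (f : {poly {poly K}})%R <= 2)%N.
  rewrite -ltnS -(size_eqX e4 e6) -[eqX e4 e6 in X in (_ < X)%N]mk_monic_eqX.
  exact: size_mk_monic.
rewrite coefD coefCM coefC coefX.
case: k => [|[|k]]; rewrite ?mulr0 ?mulr1 ?addr0 ?add0r //.
by rewrite nth_default // (leq_trans size_f).
Qed.

Lemma mkX_inj p q p' q' : mkX p q = mkX p' q' -> p = p' /\ q = q'.
Proof.
move/(congr1 (@polyn _ _)); rewrite !in_qpoly_small ?size_mkX // => /polyP pq.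
by have := pq 0; have := pq 1; rewrite !coefD !coefCM !coefC !coefX /=
  !mulr0 !mulr1 !addr0 !add0r.
Qed.

Lemma mkXD p q p' q' : mkX p q + mkX p' q' = mkX (p + p') (q + q').
Proof. by rewrite /mkX -rmorphD; congr in_qpoly; rewrite /= !polyCD; ring. Qed.

Lemma mkX_cst c : mkX c%:P 0 = cstX e4 e6 c.
Proof. by rewrite /mkX mul0r addr0. Qed.

Lemma mkX_x c : mkX (c *: 'X) 0 = xX e4 e6 * cstX e4 e6 c.
Proof. by rewrite /mkX mul0r addr0 -rmorphM /= -polyCM mulrC mul_polyC. Qed.

(* d (q y) = (deriv_y q) alpha. *)
Definition deriv_y q : {poly K} := q^`()%R * cub + q * half_dcubic e4.

(** Differentiation exchanges the summands [K[x]] and [K[x] y], so kernel and cokernel are computed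
    separately from [p |-> p'] and [deriv_y]. *)
Lemma dX_mkX p q : dX e4 e6 (mkX p q) = mkX (deriv_y q) p^`().
Proof.
rewrite /= dX_in_qpoly derXYD derXYM !derXYC derXY_X.
have -> : p^`()%:P * 'X + (q^`()%:P * 'X * 'X + q%:P * (half_dcubic e4)%:P) =
    ((deriv_y q)%:P + p^`()%:P * 'X) + q^`()%:P * eqX e4 e6.
  by rewrite /deriv_y /eqX; move: (half_dcubic e4) cub => h c;
    rewrite polyCD !polyCM; ring.
by rewrite rmorphD rmorphM /= in_qpoly_eqX mulr0 addr0.
Qed.

Lemma deriv_yD p q : deriv_y (p + q) = deriv_y p + deriv_y q.
Proof. by rewrite /deriv_y derivD; ring. Qed.

(** The top coefficient [4 * k + 6] matters: in characteristic zero [deriv_y] raises the degree by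
    exactly two. *)
Lemma coef_deriv_y q k : (deriv_y q)`_k.+2 =
  (4 * k + 6)%:R * q`_k - (60 * e4) * (q`_k.+2 *+ k.+2)
  - (140 * e6) * (q`_k.+3 *+ k.+3) - (30 * e4) * q`_k.+2.
Proof.
have -> : deriv_y q = 4 *: (q^`() * 'X^3) - (60 * e4) *: (q^`() * 'X)
    - (140 * e6) *: q^`() + 6 *: (q * 'X^2) - (30 * e4) *: q.
  by rewrite /deriv_y /cubic /half_dcubic -!mul_polyC; ring.
rewrite !coefB coefD !coefB !coefZ !coefMXn coefMX !coef_deriv /=.
have -> : (if (k.+2 < 3)%N then 0 else q`_(k.+2 - 3).+1 *+ (k.+2 - 3).+1) =
    q`_k *+ k :> K.
  by case: k => [|k] //; rewrite /= !subSS subn0.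
by rewrite !subSS subn0 /= natrD natrM -[q`_k *+ k]mulr_natr; ring.
Qed.

Hypothesis char0 : [pchar K] =i pred0.

Lemma natr_neq0 n : (0 < n)%N -> (n%:R : K) != 0.
Proof. by rewrite (proj1 (pcharf0P K) char0) lt0n. Qed.

(** For [q] of degree [m], the coefficient in degree [m + 2] is [4 m + 6] times the leading one.
    Hence [deriv_y] is injective and its image meets the span of 1 and [x] only in zero. *)
Lemma deriv_y_coef_small q :
  (forall k, (deriv_y q)`_k.+2 = 0) -> q = 0.
Proof.
move=> Tq0; apply/eqP; rewrite -size_poly_eq0; apply/negPn/negP => /negbTE sz.
case sizeq: (size q) sz => [//|m] _.
have := Tq0 m; rewrite coef_deriv_y.
rewrite ![q`__.+1]nth_default ?sizeq ?ltnS ?leqW //.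
rewrite !mul0rn !mulr0 !subr0 => /eqP; rewrite mulf_eq0.
rewrite (negbTE (natr_neq0 _)) ?addn_gt0 ?orbT //= => /eqP qm0.
have : lead_coef q == 0 by rewrite lead_coefE sizeq qm0.
by rewrite lead_coef_eq0 -size_poly_eq0 sizeq.
Qed.

Lemma deriv_y_coker p : exists q c1 c2, p = deriv_y q + c1%:P + c2 *: 'X.
Proof.
have [N] := ubnP (size p); elim: N p => // N IH p; rewrite ltnS => le_pN.
have [lep2|lt2p] := leqP (size p) 2.
  exists 0, p`_0, p`_1; rewrite /deriv_y deriv0 !mul0r !add0r.
  apply/polyP => -[|[|k]]; rewrite coefD coefC coefZ coefX /=
    ?mulr0 ?mulr1 ?addr0 ?add0r // nth_default //.
  exact: leq_trans lep2 _.
case sizep: (size p) lt2p => [|[|[|m]]] // _.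
have n0 : ((4 * m + 6)%:R : K) != 0 by rewrite natr_neq0 // addn_gt0 orbT.
(* With this choice [deriv_y q0] has the leading term of [p], of degree [m + 2]. *)
pose q0 := (p`_m.+2 / (4 * m + 6)%:R) *: 'X^m.
have [|q [c1 [c2 pE]]] := IH (p - deriv_y q0).
  rewrite (leq_trans _ le_pN) // sizep; apply/leq_sizeP => j.
  case: j => [|[|k]] // le_mk; rewrite coefB coef_deriv_y !coefZ !coefXn.
  have neq j : (k < j)%N -> (j == m) = false.
    by move=> lt_kj; rewrite gtn_eqF // (leq_ltn_trans _ lt_kj).
  rewrite (neq k.+2) ?(neq k.+3) ?ltnS ?leqnSn ?leqW //.
  rewrite !mulr0 !mul0rn !mulr0 !subr0.
  have [->|neq_km] := eqVneq k m.
    by rewrite mulr1 mulrCA divff // mulr1 subrr.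
  rewrite !mulr0 subr0 nth_default // sizep !ltnS ltn_neqAle eq_sym neq_km.
  by rewrite -ltnS -ltnS.
exists (q + q0), c1, c2.
by rewrite -[LHS](subrK (deriv_y q0)) pE deriv_yD; ring.
Qed.

Lemma deriv_surj p : exists q, q^`() = p.
Proof.
exists (\poly_(i < (size p).+1) (p`_i.-1 / i%:R)); apply/polyP => i.
rewrite coef_deriv coef_poly ltnS /=; case: ltnP => [lt_i|le_i].
  by rewrite -[LHS]mulr_natr divfK // natr_neq0.
by rewrite mul0rn nth_default.
Qed.

Lemma dX_ker (f : O) : dX e4 e6 f = 0 -> exists c, f = cstX e4 e6 c.
Proof.
have [p [q ->]] := mkX_surj f; rewrite dX_mkX.
have -> : (0 : O) = mkX 0 0 by rewrite /mkX mul0r addr0 raddf0.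
case/mkX_inj => Tq0 p'0; exists p`_0; rewrite -mkX_cst; congr mkX.
  apply/polyP => -[|k]; rewrite coefC //=.
  have /eqP := congr1 (fun p : {poly K} => p`_k) p'0.
  rewrite coef_deriv coef0 -mulr_natr mulf_eq0 (negbTE (natr_neq0 _)) // orbF.
  by move/eqP.
by apply: deriv_y_coef_small => k; rewrite Tq0 coef0.
Qed.

(** The classes of [alpha] and [x alpha] span H^1: the part in [y] has a polynomial antiderivative,
    the part in [K[x]] reduces by [deriv_y] to degree at most one. *)
Lemma dX_coker (f : O) : exists a c1 c2,
  f = dX e4 e6 a + cstX e4 e6 c1 + xX e4 e6 * cstX e4 e6 c2.
Proof.
have [p [q ->]] := mkX_surj f.
have [P <-] := deriv_surj q; have [Q [c1 [c2 ->]]] := deriv_y_coker p.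
exists (mkX P Q), c1, c2.
by rewrite dX_mkX -mkX_cst -mkX_x !mkXD !addr0.
Qed.

Lemma dX_coker_free (a : O) c1 c2 :
  dX e4 e6 a = cstX e4 e6 c1 + xX e4 e6 * cstX e4 e6 c2 -> c1 = 0 /\ c2 = 0.
Proof.
have [p [q ->]] := mkX_surj a.
rewrite dX_mkX -mkX_cst -mkX_x mkXD addr0 => /mkX_inj[Tq _].
have q0 : q = 0.
  by apply: deriv_y_coef_small => k; rewrite Tq coefD coefC coefZ coefX mulr0 addr0.
move: Tq; rewrite q0 /deriv_y deriv0 !mul0r addr0 => /polyP Tq.
have := Tq 0; have := Tq 1.
by rewrite coef0 !coefD !coefC !coefZ !coefX /= mulr0 mulr1 add0r addr0.
Qed.

End DeRham.

(** * Evaluation at the base point *)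

Section Evaluation.
Variables (K : fieldType) (e4 e6 bx b_y : K).
Hypothesis on_curve : b_y ^+ 2 = 4 * bx ^+ 3 - 60 * e4 * bx - 140 * e6.
Local Notation O := (OX e4 e6).
Local Notation ev f := (evalX idfun f bx b_y).

(** The equation of the curve vanishes at the point, so any representative may be evaluated; this
    makes evaluation a ring homomorphism. *)
Lemma evalX_in_qpoly (p : {poly {poly K}}) :
  ev (in_qpoly (eqX e4 e6) p) = p.[b_y%:P].[bx].
Proof.
have map_id (q : {poly {poly K}}) : map_poly (map_poly (idfun : K -> K)) q = q.
  by apply: map_poly_id => r _; exact: map_poly_id.
have root_eqX : (eqX e4 e6).[b_y%:P].[bx] = 0.
  by rewrite /eqX /cubic !hornerE /= on_curve; ring.
rewrite /evalX map_id /= mk_monic_eqX.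
rewrite [in RHS](Pdiv.RingMonic.rdivp_eq (eqX_monic e4 e6) p).
by rewrite !hornerD !hornerM root_eqX mulr0 add0r.
Qed.

Lemma evalXD (f g : O) : ev (f + g) = ev f + ev g.
Proof.
rewrite -[f in LHS]val_OXK -[g in LHS]val_OXK -rmorphD evalX_in_qpoly.
by rewrite !hornerD -!evalX_in_qpoly !val_OXK.
Qed.

Lemma evalXM (f g : O) : ev (f * g) = ev f * ev g.
Proof.
rewrite -[f in LHS]val_OXK -[g in LHS]val_OXK -rmorphM evalX_in_qpoly.
by rewrite !hornerM -!evalX_in_qpoly !val_OXK.
Qed.

Lemma evalX_cst c : ev (cstX e4 e6 c) = c.
Proof. by rewrite evalX_in_qpoly !hornerC. Qed.

Lemma cstX0 : cstX e4 e6 0 = 0.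
Proof. by rewrite /cstX !raddf0. Qed.

Lemma evalX0 : ev (0 : O) = 0.
Proof. by rewrite -cstX0 evalX_cst. Qed.

Lemma evalX_sum n (F : 'I_n -> O) : ev (\sum_i F i) = \sum_i ev (F i).
Proof. exact: (big_morph (fun f : O => ev f) evalXD evalX0). Qed.

End Evaluation.

(** * The truncated KZB connections in the basis of words *)

Section KZBLevels.
Variables (K : fieldType) (e4 e6 : K) (P : nat -> OX e4 e6).
Local Notation O := (OX e4 e6).
Local Notation omega := (omega_kzb P).
Local Notation E := (kzb_connection P).

(** The exponent starts with [ad_B^2], so up to length one the exponential contributes only its
    zeroth term [A]. *)
Lemma omega_kzb_small w : (size w <= 1)%N ->
  omega w = xX e4 e6 * ncB O w + ncA O w.
Proof.
move=> lew; rewrite /omega_kzb (@ncexp_kzb_stable _ _ _ _ _ 2) //.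
rewrite !big_ord_recl big_ord0 /= (@kzb_exponent_stable _ _ _ _ _ _ 2) //.
rewrite big_geq // oppr0 mulr0 !addr0 fact0 invr1.
by rewrite /cstX !rmorph1 mul1r.
Qed.

Lemma omega_kzb_nil : omega [::] = 0.
Proof. by rewrite omega_kzb_small // /ncA /ncB mulr0 addr0. Qed.

Lemma omega_kzb_A : omega [:: false] = 1.
Proof. by rewrite omega_kzb_small // /ncA /ncB mulr0 add0r. Qed.

Lemma omega_kzb_B : omega [:: true] = xX e4 e6.
Proof. by rewrite omega_kzb_small // /ncA /ncB mulr1 addr0. Qed.

(** Indexed by words of any length, so that letters can be prepended freely; words longer than [n]
    give zero. *)
Definition word_delta n (u : seq bool) : E n := nctrunc n (fun v => (v == u)%:R).

Lemma word_delta_long n u : (n < size u)%N -> word_delta n u = 0.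
Proof.
move=> ltu; apply/ffunP => w; rewrite !ffunE; case: eqP => // wu.
by have := size_bseq w; rewrite wu leqNgt ltu.
Qed.

Lemma word_deltaE n (u : n.-bseq bool) : word_delta n u = ffun_delta O u.
Proof. by apply/ffunP => w; rewrite !ffunE. Qed.

Lemma word_delta_eq0 n (M : lmodType O) (phi : {linear E n -> M}) s :
  (forall u : n.-bseq bool,
     (s : {ffun _ -> _}) u = 0 \/ phi (word_delta n u) = 0) ->
  phi s = 0.
Proof.
move=> phi0; rewrite (linear_ffunE phi) big1 // => u _.
case: (phi0 u) => [->|]; first by rewrite scale0r.
by rewrite word_deltaE => ->; rewrite scaler0.
Qed.

(* Terms of omega_KZB of degree >= 2, hence the functions P_k, only contribute
   words of length at least [size w + 2]. *)
Lemma nabla_word_delta n (M : lmodType O) (phi : {linear E n -> M}) w :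
  (forall u, ((size w).+1 < size u)%N -> phi (word_delta n u) = 0) ->
  phi (nabla (word_delta n w)) =
  - (phi (word_delta n (false :: w)) + xX e4 e6 *: phi (word_delta n (true :: w))).
Proof.
move=> phi_long; apply/eqP; rewrite -addr_eq0 -linearZ -!linearD /=.
apply/eqP/word_delta_eq0 => u.
have [lt_wu|le_uw] := ltnP (size w).+1 (size u); [by right; exact: phi_long | left].
rewrite /word_delta -nctrunc_nabla !ffunE -[xX e4 e6 *: _]/(xX e4 e6 * _).
rewrite /nabla_kzb; have -> : dX e4 e6 ((val u == w)%:R : O) = 0.
  by rewrite -cstX_nat dX_cst.
rewrite sub0r /ncmul big_ord_recl take0 omega_kzb_nil mul0r add0r.
case: (val u) le_uw => [|c v] /=; first by rewrite big_ord0 oppr0 !add0r mulr0.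
rewrite ltnS => le_vw; rewrite big_ord_recl /= take0 drop0 big1 ?addr0.
  rewrite !eqseq_cons; case: c; rewrite ?omega_kzb_A ?omega_kzb_B /=;
  case: (v == w); rewrite ?mulr0 ?mulr1 ?add0r ?addr0 ?oppr0 ?addNr //.
(* A prefix of two or more letters leaves a suffix shorter than [w]. *)
move=> i _; case: eqP => [dropE|_]; last by rewrite mulr0.
have : (size w < size v)%N; last by rewrite ltnNge le_vw.
rewrite -dropE size_drop ltn_subrL addn_gt0 /bump leq0n orbT.
exact: leq_ltn_trans (ltn_ord i).
Qed.

Lemma nabla_word_delta_long n w : (n <= size w)%N ->
  nabla (word_delta n w) = 0.
Proof.
move=> le_nw; rewrite -[LHS]/(@idfun (E n) _) nabla_word_delta /=.
  by rewrite !word_delta_long //= scaler0 addr0 oppr0.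
by move=> u lt_u; rewrite word_delta_long // (leq_ltn_trans le_nw) // ltnW.
Qed.

Section LongWords.
Variable n : nat.
Let W := [set w : n.-bseq bool | size w == n].

(** Words of length exactly [n] span a trivial subconnection, since prepending a letter leaves the
    truncation. *)
Definition long_word_incl : {linear trivial_connection (dX e4 e6) #|W| -> E n} :=
  ffun_comb (M := E n) (fun k => ffun_delta O (@enum_val _ (mem W) k)).

Lemma long_word_incl_horizontal : horizontal long_word_incl.
Proof.
apply: horizontal_comb => k; rewrite -word_deltaE.
apply: nabla_word_delta_long.
by have := enum_valP k; rewrite inE => /eqP->.
Qed.

Lemma long_word_incl_inj : injective long_word_incl.
Proof. exact: coordinate_incl_inj enum_val_inj. Qed.

Lemma long_word_incl_image s :
  (forall w : n.-bseq bool, (size w < n)%N -> (s : {ffun _ -> _}) w = 0) <->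
  exists t, long_word_incl t = s.
Proof.
rewrite -[X in _ <-> X](@coordinate_incl_image _ _ _ (@enum_val _ (mem W))
  enum_val_inj s).
have out (w : n.-bseq bool) :
    (w \notin codom (@enum_val _ (mem W))) = (size w < n)%N.
  rewrite ltn_neqAle size_bseq andbT; congr (~~ _).
  apply/codomP/idP => [[k ->]|wn]; first by have := enum_valP k; rewrite inE.
  have Ww : w \in W by rewrite inE.
  by exists (enum_rank_in Ww w); rewrite enum_rankK_in.
by split=> s0 w; [rewrite out | rewrite -out]; exact: s0.
Qed.

End LongWords.

(** Dropping the longest words exhibits each level as an extension of the previous one by a trivial
    connection. *)
Lemma unipotent_kzb_level n : unipotent (E n).
Proof.
elim: n => [|n IH].
  (* Level 0 is trivial only up to isomorphism, hence enters as an extension of the connection of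
     rank 0. *)
  have z_lin : linear (fun _ : E 0 => 0 : trivial_connection (dX e4 e6) 0).
    by move=> a s t; rewrite scaler0 addr0.
  apply: (@unipotent_extension _ _ _ _ _ (long_word_incl 0) (linear_pack z_lin)).
  - split; [exact: long_word_incl_horizontal | | exact: long_word_incl_inj | |].
    + by move=> s; apply/ffunP; case.
    + by move=> t; exists 0; apply/ffunP; case.
    + by move=> s; split=> // _; apply/long_word_incl_image.
  - exact: unipotent_trivial.
  - exact: unipotent_trivial.
apply: (@unipotent_extension _ _ _ _ _
  (long_word_incl n.+1) (trans E (leqnSn n))) IH.
  split; [exact: long_word_incl_horizontal | exact: trans_horizontal
    | exact: long_word_incl_inj | |].
  - move=> t; exists (nctrunc n.+1 (ncext t)).
    by rewrite /= kzb_trans_trunc; apply/ffunP => w; rewrite ffunE ncextE.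
  - move=> s; rewrite -long_word_incl_image; split=> [s0 w|s0].
      rewrite ltnS => le_wn; have /ffunP/(_ (Bseq le_wn)) := s0.
      by rewrite !ffunE => <-; congr (s _); exact: val_inj.
    by apply/ffunP => w; rewrite !ffunE s0 //= ltnS size_bseq.
exact: unipotent_trivial.
Qed.

End KZBLevels.

(** * Universality of the KZB connection *)

Section KZBUniversal.
Variables (K : fieldType) (e4 e6 : K) (P : nat -> OX e4 e6).
Local Notation O := (OX e4 e6).
Local Notation E := (kzb_connection P).
Local Notation cst := (cstX e4 e6).
Local Notation x := (xX e4 e6).
Hypothesis char0 : [pchar K] =i pred0.

Lemma word_delta_trans m n (le_mn : (m <= n)%N) u :
  trans E le_mn (word_delta P n u) = word_delta P m u.
Proof. exact: kzb_trans_trunc. Qed.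

(* The values of [eps] on the longest words [w] that it does not kill are exact
   up to constants and constant multiples of x, which the words [A w] and [B w]
   absorb. *)
Lemma defect_long_words n j r
    (eps : {linear E n -> trivial_connection (dX e4 e6) r}) : (j <= n)%N ->
  (forall u, (j <= size u)%N -> eps (word_delta P n u) = 0) ->
  exists psi : {linear E n -> trivial_connection (dX e4 e6) r},
    forall s, eps s = defect psi s.
Proof.
elim: j eps => [|j IH] eps lt_jn eps_long.
  have z_lin : linear (fun _ : E n => 0 : trivial_connection (dX e4 e6) r).
    by move=> a s t; rewrite scaler0 addr0.
  exists (linear_pack z_lin) => s.
  have -> : defect (linear_pack z_lin) s = 0.
    exact: etrans (subr0 _) (nabla0 (trivial_connection (dX e4 e6) r)).
  by apply: word_delta_eq0 => u; right; apply: eps_long.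
pose T := trivial_connection (dX e4 e6) r.
(* Coordinatewise, a section is exact up to a flat section and [x] times another. *)
have coker (f : T) : exists acc : T * T * T,
    [/\ f = nabla acc.1.1 + (acc.1.2 + x *: acc.2),
        nabla acc.1.2 = 0 & nabla acc.2 = 0].
  have [a aE] := boolp.choice (fun i => dX_coker char0 (f i)).
  have [c1 c1E] := boolp.choice aE; have [c2 c2E] := boolp.choice c1E.
  exists ([ffun i => a i], [ffun i => cst (c1 i)], [ffun i => cst (c2 i)]).
  split; apply/ffunP => i; rewrite !ffunE ?dX_cst // [LHS]c2E.
  by rewrite -addrA.
have [acc accE] := boolp.choice (fun u => coker (eps (word_delta P n u))).
(* Up to longer words [nabla] sends [w] to [-(A w + x B w)], so for [w] of length [j] the defect of
   [psi] is [nabla (a w) + a (A w) + x a (B w)]; the three components of [acc w] make it equal to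
   [eps] there. *)
pose a (u : seq bool) : T :=
  if size u == j then (acc u).1.1 else
  if size u == j.+1 then
    if head false u then (acc (behead u)).2 else (acc (behead u)).1.2
  else 0.
have a_j u : size u = j -> a u = (acc u).1.1 by rewrite /a => ->; rewrite eqxx.
have a_Sj b u : size u = j -> a (b :: u) = if b then (acc u).2 else (acc u).1.2.
  by rewrite /a /= => ->; rewrite gtn_eqF // eqxx.
pose psi : {linear E n -> T} := ffun_comb (M := T) (fun u : n.-bseq bool => a u).
have psiE u : (size u <= n)%N -> psi (word_delta P n u) = a u.
  move=> le_un; rewrite -[u]/(val (Bseq le_un)) word_deltaE.
  exact: (ffun_comb_delta (M := T)).
have psi_long u : (j.+1 < size u)%N -> psi (word_delta P n u) = 0.
  move=> lt_ju; have [le_un|lt_nu] := leqP (size u) n.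
    by rewrite psiE // /a !gtn_eqF // ltnW.
  by rewrite word_delta_long // linear0.
have [||psi' psi'E] := IH (eps \- defect psi).
- exact: ltnW.
- move=> u le_ju.
  change (eps (word_delta P n u) - (nabla (psi (word_delta P n u)) -
    psi (nabla (word_delta P n u : E n))) = 0).
  rewrite (nabla_word_delta (phi := psi)); last first.
    by move=> w lt_uw; apply: psi_long; rewrite (leq_ltn_trans _ lt_uw).
  have [sz_u|neq_uj] := eqVneq (size u) j.
    have [epsE _ _] := accE u.
    rewrite !psiE ?[size (_ :: _)]/= ?sz_u // ?(ltnW lt_jn) // a_j // !a_Sj //.
    by rewrite opprK epsE subrr.
  have lt_ju : (j < size u)%N by rewrite ltn_neqAle eq_sym neq_uj.
  rewrite eps_long // (psi_long (false :: u)) // (psi_long (true :: u)) //.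
  rewrite [_ *: _]scaler0 addr0 oppr0 subr0 sub0r.
  apply/eqP; rewrite oppr_eq0; apply/eqP.
  have [lt_ju'|le_uj] := ltnP j.+1 (size u); first by rewrite psi_long // nabla0.
  have sz_u : size u = j.+1 by apply/eqP; rewrite eqn_leq le_uj.
  (* On words of length [j + 1] the values of [psi] are flat, so no new defect appears. *)
  rewrite psiE ?sz_u // /a sz_u gtn_eqF // eqxx.
  by case: (accE (behead u)) => _; case: (head _ _).
exists (psi \+ psi') => s.
by rewrite defectD -psi'E /= addrC subrK.
Qed.

(** One more level leaves room for the letters prepended to words of length [n], and the pulled back
    map kills the words of length [n + 1]. *)
Lemma acyclic_kzb_trivial r : acyclic E (trivial_connection (dX e4 e6) r).
Proof.
move=> n eps.
have [|u lt_nu|psi psiE] :=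
    @defect_long_words n.+1 n.+1 r (eps \o trans E (leqnSn n)).
- by [].
- rewrite /= -[kzb_trans_fun _ _]/(trans E _ _) word_delta_trans.
  by rewrite word_delta_long // linear0.
by exists n.+1, (leqnSn n), psi.
Qed.

Section Fibre.
Variables bx b_y : K.
Hypothesis on_curve : b_y ^+ 2 = 4 * bx ^+ 3 - 60 * e4 * bx - 140 * e6.
Local Notation ev := (fun f : OX e4 e6 => evalX idfun f bx b_y).

Lemma fibre_null_trivial r (t : trivial_connection (dX e4 e6) r) :
  fibre_null ev t <-> forall i, ev ((t : {ffun _ -> _}) i) = 0.
Proof.
split=> [[n [f [u [f0 ->]]]] i|t0].
  rewrite sum_ffunE (evalX_sum on_curve) big1 // => k _.
  by rewrite ffunE [LHS](evalXM on_curve) f0 mul0r.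
by exists r, t, (@ffun_delta O _); split=> //; exact: ffun_deltaE.
Qed.

(** Level 0 suffices: the section whose constant coordinates are the values of [v] at the base point
    is flat and equals [v] in the fibre. *)
Lemma section_extends_kzb_trivial r :
  section_extends ev (kzb_marking P) (trivial_connection (dX e4 e6) r).
Proof.
move=> v; pose T := trivial_connection (dX e4 e6) r.
pose c : T := [ffun i => cst (ev ((v : {ffun _ -> _}) i))].
pose phi : {linear E 0 -> T} := ffun_comb (M := T) (fun=> c).
have phi1 : phi (kzb_marking P 0) = c.
  have -> : kzb_marking P 0 = ffun_delta O [bseq] by rewrite -word_deltaE.
  exact: (ffun_comb_delta (M := T)).
exists 0, phi; split.
  apply/horizontal_defect => s; apply: word_delta_eq0 => u; right.
  have u0 : val u = [::] by apply/nilP; rewrite /nilp -leqn0 size_bseq.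
  change (nabla (phi (word_delta P 0 u)) -
    phi (nabla (word_delta P 0 u : E 0)) = 0).
  rewrite nabla_word_delta_long // u0 -[word_delta P 0 [::]]/(kzb_marking P 0).
  rewrite phi1 linear0 subr0; apply/ffunP => i; rewrite !ffunE; exact: dX_cst.
rewrite phi1 -fibre_null_subproof; apply/fibre_null_trivial => i.
rewrite !ffunE (evalXD on_curve) (evalX_cst on_curve) -(evalXD on_curve).
by rewrite subrr (evalX0 on_curve).
Qed.

(** Descending induction on length: once longer words are killed, the values on the longest
    remaining ones are flat, hence constant. Horizontality at [w] then makes [c1 + x c2] a
    derivative, and independence in H^1 forces both constants to vanish. *)
Lemma horizontal_trivial_word n r
    (phi : {linear E n -> trivial_connection (dX e4 e6) r}) :
  horizontal phi -> forall u, (0 < size u)%N -> phi (word_delta P n u) = 0.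
Proof.
move=> phi_hor.
have step j : (forall u, (j.+1 < size u)%N -> phi (word_delta P n u) = 0) ->
    forall u, (j < size u)%N -> phi (word_delta P n u) = 0.
  move=> phi_long u lt_ju.
  have [lt_ju'|le_uj] := ltnP j.+1 (size u); first exact: phi_long.
  have sz_u : size u = j.+1 by apply/eqP; rewrite eqn_leq le_uj.
  have const w : size w = j.+1 ->
      exists c : 'I_r -> K, phi (word_delta P n w) = [ffun i => cst (c i)].
    move=> sz_w.
    have : nabla (phi (word_delta P n w)) = 0.
      rewrite -phi_hor nabla_word_delta; last first.
        by move=> w' lt_w'; apply: phi_long; rewrite -sz_w ltnW.
      by rewrite !phi_long /= ?sz_w // scaler0 addr0 oppr0.
    move=> /ffunP dphi0.
    have [i|c cE] := boolp.choice (fun i => dX_ker char0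
        (_ : dX e4 e6 ((phi (word_delta P n w) : {ffun _ -> _}) i) = 0)).
      by have := dphi0 i; rewrite !ffunE.
    by exists c; apply/ffunP => i; rewrite ffunE cE.
  case: u sz_u {lt_ju le_uj} => // b w [sz_w].
  have [|c1 c1E] := const (false :: w); first by rewrite /= sz_w.
  have [|c2 c2E] := const (true :: w); first by rewrite /= sz_w.
  have /ffunP dphi : nabla (phi (word_delta P n w)) =
     - (phi (word_delta P n (false :: w)) + x *: phi (word_delta P n (true :: w))).
    rewrite -phi_hor nabla_word_delta // => w' lt_w'; apply: phi_long.
    by rewrite -sz_w.
  have c0 i : c1 i = 0 /\ c2 i = 0.
    apply: (@dX_coker_free _ e4 e6 char0
      (- (phi (word_delta P n w) : {ffun _ -> _}) i)).
    have := dphi i; rewrite c1E c2E !ffunE derN => ->.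
    by rewrite opprK.
  by case: b; rewrite ?c1E ?c2E; apply/ffunP => i; rewrite !ffunE;
    have [c10 c20] := c0 i; rewrite ?c10 ?c20 cstX0.
have {}step N : (forall u, (N < size u)%N -> phi (word_delta P n u) = 0) ->
    forall u, (0 < size u)%N -> phi (word_delta P n u) = 0.
  by elim: N => // N IH /step.
by apply: (step n) => u lt_nu; rewrite word_delta_long // linear0.
Qed.

(** Only the empty word is left; its value is flat, hence constant, and a constant vanishing at the
    base point is zero. *)
Lemma section_unique_kzb_trivial r :
  section_unique ev (kzb_marking P) (trivial_connection (dX e4 e6) r).
Proof.
move=> n phi phi_hor /fibre_null_trivial phi_null.
have phi_word := horizontal_trivial_word phi_hor.
exists n, (leqnn n) => s; rewrite trans_id; apply: word_delta_eq0 => u; right.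
case: u => -[|b w] le_wn /=; last exact: phi_word.
apply/ffunP => i; have := phi_null i.
have : nabla (phi (word_delta P n [::])) = 0.
  rewrite -phi_hor nabla_word_delta.
    by rewrite !phi_word // scaler0 addr0 oppr0.
  by move=> u lt_u; apply: phi_word; rewrite (ltn_trans _ lt_u).
move=> /ffunP/(_ i); rewrite !ffunE => /(dX_ker char0)[c cE].
rewrite -[kzb_marking P n]/(word_delta P n [::]) cE (evalX_cst on_curve) => ->.
exact: cstX0.
Qed.

Theorem kzb_universal :
  universal_pointed_unipotent ev (kzb_connection P) (kzb_marking P).
Proof.
apply: universal_criterion.
- exact: unipotent_kzb_level.
- by move=> m n le_mn; rewrite [trans _ _ _]kzb_trans_trunc; exact: fibre_eq_refl.
- exact: acyclic_kzb_trivial.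
- exact: section_extends_kzb_trivial.
- exact: section_unique_kzb_trivial.
Qed.

End Fibre.
End KZBUniversal.

Theorem proposition5
    (K : fieldType) (v : K -> int)
    (hK : nonarch_local_field v) (char0 : [pchar K] =i pred0)
    (e4 e6 : K)
    (hE : nonsingular e4 e6) (hgood : good_reduction v e4 e6)
    (bx b_y : K)
    (hb : b_y ^+ 2 = 4 * bx ^+ 3 - 60 * e4 * bx - 140 * e6)
    (R : realType) (iota : {rmorphism K -> R[i]})
    (r : R[i]) (wp : R[i] -> R[i]) (e : nat -> R[i])
    (hwp : abel_jacobi (iota e4) (iota e6) r wp e)
    (P : nat -> OX e4 e6) (hP : kzb_functions iota r wp e P) :
  universal_pointed_unipotent
    (fun f : OX e4 e6 => evalX idfun f bx b_y)
    (kzb_connection P) (kzb_marking P).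
Proof. exact: kzb_universal. Qed.
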